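(* Let $\Phi:[0,\ell(I)[\,\to\mathbb{R}_+$ be an absolutely subadditive error function with $\Phi(0)=0$ and let $f:I\to\mathbb{R}$. Then the following assertions are equivalent to each other: (i) $f$ is $\Phi$-Hölder. (ii) For every $p\in I$, the functions $f(p)-\Phi_p$ and $f(p)+\Phi_p$ are $\Phi$-Hölder interpolations of $f$ at $p$ from below and above, respectively. (iii) For every $p\in I$, $f$ possesses a $\Phi$-Hölder interpolation at $p$ from below. (iv) For every $p\in I$, $f$ possesses a $\Phi$-Hölder interpolation at $p$ from above.
   Context: $I$ is a nonempty open real interval and $\ell(I)\in\,]0,\infty]$ is its length; $\mathbb{R}_+=[0,\infty[$. An error function is any function $\Phi:[0,\ell(I)[\,\to\mathbb{R}_+$. It is absolutely subadditive if $\Phi(|u+v|)\le\Phi(|u|)+\Phi(|v|)$ for all $u,v\in\mathbb{R}$ with $|u|,|v|,|u+v|<\ell(I)$. A function $g:I\to\mathbb{R}$ is $\Phi$-Hölder if $|g(x)-g(y)|\le\Phi(|x-y|)$ for all $x,y\in I$. For $p\in I$, $\Phi_p:I\to\mathbb{R}$ is defined by $\Phi_p(x):=\Phi(|x-p|)$. A function $g:I\to\mathbb{R}$ is a $\Phi$-Hölder interpolation of $f$ at $p$ from below [resp. from above] if $g$ is $\Phi$-Hölder, $g(p)=f(p)$ and $g\le f$ [resp. $f\le g$] on $I$. *)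

(* Defs.v *)
From mathcomp Require Import all_boot all_order all_algebra.
From mathcomp Require Import all_classical all_reals all_analysis.

Set Implicit Arguments.
Unset Strict Implicit.
Unset Printing Implicit Defensive.

Import Order.TTheory GRing.Theory Num.Theory.
Import numFieldNormedType.Exports.

Local Open Scope classical_set_scope.
Local Open Scope ring_scope.

(* Functions on a subset of R are represented by total functions R -> R, of
   which only the values on that subset are ever constrained or used. *)

Definition open_interval (R : realType) (I : set R) : Prop :=
  [/\ is_interval I, open I & I !=set0].

(* Right endpoint minus left endpoint; +oo as soon as one of them is infinite
   (for nonempty I the supremum is not -oo and the infimum is not +oo). *)
Definition interval_length (R : realType) (I : set R) : \bar R :=
  (ereal_sup (EFin @` I) - ereal_inf (EFin @` I))%E.

Definition error_function (R : realType) (I : set R) (Phi : R -> R) : Prop :=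
  set_fun [set t | 0 <= t /\ (t%:E < interval_length I)%E] [set y | 0 <= y]
    Phi.

Definition absolutely_subadditive (R : realType) (I : set R) (Phi : R -> R) :
    Prop :=
  forall u v : R,
    (`|u|%:E < interval_length I)%E -> (`|v|%:E < interval_length I)%E ->
    (`|u + v|%:E < interval_length I)%E ->
    Phi `|u + v| <= Phi `|u| + Phi `|v|.

Definition Phi_holder (R : realType) (I : set R) (Phi g : R -> R) : Prop :=
  forall x y : R, I x -> I y -> `|g x - g y| <= Phi `|x - y|.

Definition error_at (R : realType) (Phi : R -> R) (p : R) : R -> R :=
  fun x => Phi `|x - p|.

Definition holder_interpolation_below (R : realType) (I : set R)
    (Phi f : R -> R) (p : R) (g : R -> R) : Prop :=
  [/\ Phi_holder I Phi g, g p = f p & forall x, I x -> g x <= f x].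

Definition holder_interpolation_above (R : realType) (I : set R)
    (Phi f : R -> R) (p : R) (g : R -> R) : Prop :=
  [/\ Phi_holder I Phi g, g p = f p & forall x, I x -> f x <= g x].

(* Main.v *)
Require Import Defs.
From mathcomp Require Import all_boot all_order all_algebra.
From mathcomp Require Import all_classical all_reals all_analysis.

Import Order.TTheory GRing.Theory Num.Theory.
Import numFieldNormedType.Exports.

Local Open Scope classical_set_scope.
Local Open Scope ring_scope.

(** Subadditivity makes [Phi |x - y|] obey the triangle inequality, so its reverse form shows that
    [Phi_p] is itself Hölder ([error_at_holder]). For Hölder [f], the functions [f p - Phi_p] and
    [f p + Phi_p] are therefore Hölder and enclose [f], touching it at [p]. Conversely, a one-sided
    Hölder interpolation at each point transfers its increment bound to [f], and the symmetry of
    [|x - y|] turns this one-sided bound into a two-sided one. *)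

(* Openness makes the inequality strict: some point of I lies beyond the larger
   of the two. *)
Lemma dist_lt_interval_length (R : realType) (I : set R) (x y : R) :
  open I -> I x -> I y -> (`|x - y|%:E < interval_length I)%E.
Proof.
move=> oI; wlog le_yx : x y / y <= x.
  move=> H Ix Iy; case: (leP y x) => [|/ltW] le; first exact: H.
  by rewrite distrC; apply: H.
move=> Ix Iy; rewrite ger0_norm ?subr_ge0//.
have [e /= e0 eI] : nbhs_ball x I by apply/nbhs_ballP; exact: open_nbhs_nbhs.
have Iz : I (x + e / 2).
  apply: eI; rewrite /ball /= opprD addNKr normrN gtr0_norm ?divr_gt0//.
  by rewrite ltr_pdivrMr// ltr_pMr// ltr1n.
apply: (@lt_le_trans _ _ (x + e / 2 - y)%:E).
  by rewrite lte_fin ltrD2r ltrDl divr_gt0.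
rewrite EFinB /interval_length; apply: leeB.
  by apply: ereal_sup_ubound; exists (x + e / 2).
by apply: ereal_inf_lbound; exists y.
Qed.

(** Both inequalities come from splitting [x - p] as [(x - y) + (y - p)], then exchanging [x] and
    [y]. All differences lie in the domain of subadditivity by [dist_lt_interval_length]. *)
Lemma error_at_holder (R : realType) (I : set R) (Phi : R -> R) (p : R) :
  open I -> absolutely_subadditive I Phi -> I p ->
  Phi_holder I Phi (error_at Phi p).
Proof.
move=> oI hsub Ip.
have tri x y : I x -> I y -> Phi `|x - p| <= Phi `|x - y| + Phi `|y - p|.
  move=> Ix Iy; have := hsub (x - y) (y - p); rewrite addrA subrK.
  by apply; apply: dist_lt_interval_length.
move=> x y Ix Iy; rewrite /error_at ler_distl lerBlDl.
by rewrite [X in _ && (_ <= X)]addrC tri// andbT (distrC x y) tri.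
Qed.

(** Adding a constant or changing sign preserves the Hölder bound, [Phi 0 = 0] gives contact at [p],
    and the enclosure is the Hölder bound of [f] for the pair [x], [p]. *)
Lemma holder_interpolation_error (R : realType) (I : set R) (Phi f : R -> R)
    (p : R) :
  open I -> absolutely_subadditive I Phi -> Phi 0 = 0 -> Phi_holder I Phi f ->
  I p ->
  holder_interpolation_below I Phi f p (fun x => f p - error_at Phi p x) /\
  holder_interpolation_above I Phi f p (fun x => f p + error_at Phi p x).
Proof.
move=> oI hsub Phi0 hf Ip.
have hPhi_p := error_at_holder _ _ _ _ oI hsub Ip.
split; split.
- move=> x y Ix Iy; rewrite opprB addrC addrA subrK distrC.
  exact: hPhi_p.
- by rewrite /error_at subrr normr0 Phi0 subr0.
- by move=> x Ix; have := hf x p Ix Ip; rewrite ler_distl => /andP[].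
- move=> x y Ix Iy; rewrite opprD addrACA subrr add0r; exact: hPhi_p.
- by rewrite /error_at subrr normr0 Phi0 addr0.
- by move=> x Ix; have := hf x p Ix Ip; rewrite ler_distl => /andP[].
Qed.

Lemma holder_of_one_sided (R : realType) (I : set R) (Phi f : R -> R) :
  (forall x y, I x -> I y -> f x - f y <= Phi `|x - y|) -> Phi_holder I Phi f.
Proof.
move=> hf x y Ix Iy; rewrite ler_norml lerNl opprB hf// andbT.
by rewrite distrC hf.
Qed.

(** With contact at [x], [f x - f y = g x - f y <= g x - g y], since [g y <= f y]. *)
Lemma holder_of_interpolation_below (R : realType) (I : set R)
    (Phi f : R -> R) :
  (forall p, I p -> exists g, holder_interpolation_below I Phi f p g) ->
  Phi_holder I Phi f.
Proof.
move=> hbelow; apply: holder_of_one_sided => x y Ix Iy.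
have [g [hg <- le_gf]] := hbelow x Ix.
apply: le_trans (le_trans (ler_norm _) (hg x y Ix Iy)).
by rewrite lerD2l lerN2 le_gf.
Qed.

Lemma holder_of_interpolation_above (R : realType) (I : set R)
    (Phi f : R -> R) :
  (forall p, I p -> exists g, holder_interpolation_above I Phi f p g) ->
  Phi_holder I Phi f.
Proof.
move=> habove; apply: holder_of_one_sided => x y Ix Iy.
(* An upper bound can only replace the positive term [f x], so contact is now taken at [y]. *)
have [g [hg <- le_fg]] := habove y Iy.
apply: le_trans (le_trans (ler_norm _) (hg x y Ix Iy)).
by rewrite lerD2r le_fg.
Qed.

Theorem theorem4p3 (R : realType) (I : set R) (hI : open_interval I)
    (Phi : R -> R) (hPhi : error_function I Phi)
    (hsub : absolutely_subadditive I Phi) (hPhi0 : Phi 0 = 0)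
    (f : R -> R) :
  [<-> (* (i) *) Phi_holder I Phi f;
       (* (ii) *) forall p : R, I p ->
         holder_interpolation_below I Phi f p
           (fun x => f p - error_at Phi p x) /\
         holder_interpolation_above I Phi f p
           (fun x => f p + error_at Phi p x);
       (* (iii) *) forall p : R, I p ->
         exists g : R -> R, holder_interpolation_below I Phi f p g;
       (* (iv) *) forall p : R, I p ->
         exists g : R -> R, holder_interpolation_above I Phi f p g].
Proof.
have oI : open I by case: hI.
tfae.
- by move=> hf p; exact: holder_interpolation_error.
- by move=> h p Ip; have [hbelow _] := h p Ip; eexists; exact: hbelow.
(* The passage from below to above goes through the Hölder property of [f]. *)
- move=> /holder_of_interpolation_below hf p Ip.
  have [_ habove] :=
    holder_interpolation_error _ _ _ _ _ oI hsub hPhi0 hf Ip.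
  by eexists; exact: habove.
- exact: holder_of_interpolation_above.
Qed.
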